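(* Let $N\ge 2$ and let $x_N\ge x_{N-1}\ge\dots\ge x_1>0$ be the users' SNRs. Let $$O=\{\{U_2,U_1\},\{U_3,U_1\},\dots,\{U_N,U_1\}\}.$$ (i) $O$ is an optimal ordering for the sum rate subject to the (untruncated) bounds $R_i\le\frac{1}{2(N-1)}\log_2\left(\frac{x_i}{x_i+x_j}+x_i\right)$ for $\{U_i,U_j\}$ in the ordering; that is, $S_R^{w}(G_{O})\ge S_R^{w}(G_{O'})$ for every feasible ordering $O'$ (with $N-1$ pairs). (ii) The maximum sum rate for this ordering (with rates subject to the truncated bounds $R_i\le\max\left\{0,\frac{1}{2(N-1)}\log_2\left(\frac{x_i}{x_i+x_j}+x_i\right)\right\}$ for $\{U_i,U_j\}$ in the ordering) is $$S_R(G_O)=\frac{1}{2(N-1)}\log_2\left(\max\left\{1,\;x_1+\frac{x_1}{x_1+x_N}\right\}\times\prod_{i=2}^{N}\max\left\{1,\;\frac{x_i}{x_i+x_1}+x_i\right\}\right).$$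
   Context: There are $N\ge2$ users $U_1,\dots,U_N$ with SNRs $x_N\ge\dots\ge x_1>0$ (real numbers). An ordering is a set of unordered pairs of distinct users; its client graph $G_O=(V,E)$ is the simple graph on $V=\{v_1,\dots,v_N\}$ with $v_iv_j\in E$ iff $\{U_i,U_j\}\in O$. Only orderings with $N-1$ pairs are considered; such an ordering is feasible exactly when $G_O$ is a tree. For a feasible ordering $O$ define $$B^w_i(G_O)=\min_{j:\,v_iv_j\in E}\frac{1}{2(N-1)}\log_2\left(x_i+\frac{x_i}{x_i+x_j}\right),\qquad B_i(G_O)=\max\{0,B_i^w(G_O)\}.$$ $B_i^w$ is the maximum rate of $U_i$ subject to the untruncated bounds, and $B_i$ is the maximum rate of $U_i$ subject to the bounds $R_i\le\max\left\{0,\frac{1}{2(N-1)}\log_2\left(\frac{x_i}{x_i+x_j}+x_i\right)\right\}$ over all pairs containing $U_i$. The corresponding maximum sum rates are $S_R^w(G_O)=\sum_{i=1}^N B_i^w(G_O)$ and $S_R(G_O)=\sum_{i=1}^N B_i(G_O)$. (The two notions coincide when $x_1+\frac{x_1}{x_1+x_N}\ge1$.) *)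

(* Defs.v *)
From HB Require Import structures.
From mathcomp Require Import all_boot all_order all_algebra.
From mathcomp Require Import reals exp.

Set Implicit Arguments.
Unset Strict Implicit.
Unset Printing Implicit Defensive.
Import Order.TTheory GRing.Theory Num.Theory.
Local Open Scope ring_scope.

(* Users are indexed from 0: the user U_k is k - 1 : 'I_N, so that U_1 has
   value 0 and U_N has value N.-1. *)
Definition first_user (N : nat) (hN : (2 <= N)%N) : 'I_N := Ordinal (ltnW hN).

Lemma last_user_subproof (N : nat) : (2 <= N)%N -> (N.-1 < N)%N.
Proof. by case: N. Qed.

Definition last_user (N : nat) (hN : (2 <= N)%N) : 'I_N :=
  Ordinal (last_user_subproof hN).

Definition ordering (N : nat) (O : {set {set 'I_N}}) : Prop :=
  forall P : {set 'I_N}, P \in O -> #|P| = 2%N.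

(* If [O] is an ordering this relation is irreflexive, since [set i; i] has
   cardinal 1, hence it is the adjacency relation of a simple graph. *)
Definition client_graph (N : nat) (O : {set {set 'I_N}}) : rel 'I_N :=
  fun i j => [set i; j] \in O.

(* In a simple graph the duplicate-free closed walks on at least three
   vertices are exactly the cycles. *)
Definition is_tree (T : finType) (e : rel T) : Prop :=
  (forall u v : T, connect e u v) /\
  (forall c : seq T, ucycle e c -> (size c <= 2)%N).

Definition feasible (N : nat) (O : {set {set 'I_N}}) : Prop :=
  [/\ ordering O, #|O| = N.-1 & is_tree (client_graph O)].

(* The minimum of [F] over a finite nonempty set of indices, 0 if the set is
   empty; the base value [F i0] is itself one of the values considered. *)
Definition min_over (R : realType) (T : finType) (P : pred T) (F : T -> R) : R :=
  if [pick i | P i] is Some i0 then \big[Num.min/F i0]_(i | P i) F i else 0.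

Lemma min_overP (R : realType) (T : finType) (P : pred T) (F : T -> R) (k : T) :
  P k ->
  (exists2 i, P i & min_over P F = F i) /\
  (forall i, P i -> min_over P F <= F i).
Proof.
rewrite /min_over; case: pickP => [i0 Pi0 _|P0]; last by rewrite P0.
split; last by move=> i Pi; apply: bigmin_le_cond.
elim/big_ind: _ => [|a b [i Pi ->] [j Pj ->]|i Pi].
- by exists i0.
- by rewrite /Num.min; case: ifP => _; [exists i | exists j].
- by exists i.
Qed.

Definition log2 (R : realType) (y : R) : R := ln y / ln 2.

Definition rate_bound (R : realType) (N : nat) (x : 'I_N -> R) (i j : 'I_N) : R :=
  (2 * (N%:R - 1))^-1 * log2 (x i + x i / (x i + x j)).

Definition Bw (R : realType) (N : nat) (x : 'I_N -> R) (e : rel 'I_N)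
    (i : 'I_N) : R :=
  min_over (e i) (rate_bound x i).

Definition B (R : realType) (N : nat) (x : 'I_N -> R) (e : rel 'I_N)
    (i : 'I_N) : R :=
  Num.max 0 (Bw x e i).

Definition SRw (R : realType) (N : nat) (x : 'I_N -> R) (e : rel 'I_N) : R :=
  \sum_(i < N) Bw x e i.

Definition SR (R : realType) (N : nat) (x : 'I_N -> R) (e : rel 'I_N) : R :=
  \sum_(i < N) B x e i.

Definition admissible (R : realType) (N : nat) (e : rel 'I_N)
    (bound : 'I_N -> 'I_N -> R) (r : 'I_N -> R) : Prop :=
  forall i j, e i j -> r i <= bound i j.

(* [SRw] and [SR] are the maxima of the sum of the rates [r] subject to the
   untruncated and truncated bounds, respectively, on a graph without isolated
   vertices (in particular on a tree with at least two vertices). *)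
Lemma SRw_max (R : realType) (N : nat) (x : 'I_N -> R) (e : rel 'I_N) :
  (forall i, exists j, e i j) ->
  (exists2 r, admissible e (rate_bound x) r & \sum_(i < N) r i = SRw x e) /\
  (forall r, admissible e (rate_bound x) r -> \sum_(i < N) r i <= SRw x e).
Proof.
move=> nbr; split=> [|r hr].
  exists (Bw x e) => // i j eij.
  by have [_ ->] := min_overP (P := e i) (rate_bound x i) eij.
apply: ler_sum => i _; have [j eij] := nbr i; rewrite /Bw.
by have [[k eik ->] _] := min_overP (P := e i) (rate_bound x i) eij; apply: hr.
Qed.

Lemma SR_max (R : realType) (N : nat) (x : 'I_N -> R) (e : rel 'I_N)
    (bound := fun i j => Num.max 0 (rate_bound x i j)) :
  (forall i, exists j, e i j) ->
  (exists2 r, admissible e bound r & \sum_(i < N) r i = SR x e) /\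
  (forall r, admissible e bound r -> \sum_(i < N) r i <= SR x e).
Proof.
move=> nbr; split=> [|r hr].
  exists (B x e) => // i j eij; rewrite /B ge_max !le_max lexx /= /Bw.
  by have [_ ->] := min_overP (P := e i) (rate_bound x i) eij; rewrite // orbT.
apply: ler_sum => i _; have [j eij] := nbr i; rewrite /B /Bw.
have [[k eik ->] _] := min_overP (P := e i) (rate_bound x i) eij.
exact: (hr i k eik).
Qed.

Definition optimal_ordering (R : realType) (N : nat) (x : 'I_N -> R)
    (O : {set {set 'I_N}}) : Prop :=
  feasible O /\
  forall O' : {set {set 'I_N}}, feasible O' ->
    SRw x (client_graph O) >= SRw x (client_graph O').

Definition star_ordering (N : nat) (hN : (2 <= N)%N) : {set {set 'I_N}} :=
  [set [set i; first_user hN] | i : 'I_N & i != first_user hN].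

(* Main.v *)
(* Write a + a/(a+b) = a (1 + 1/(a+b)); up to terms that do not depend on the
   graph, a user i with neighbour j has rate at most h(x_i + x_j), where
   h(s) = c log2(1 + 1/s) is nonincreasing.  In a connected graph choose a
   simple path from U_1 to U_N.  Along it, charge the edge from i to its
   successor j to the user j: h(x_i + x_j) <= h(x_j + x_1).  Every other user,
   and U_N itself, has rate at most h(x_i + x_1).  The sum telescopes to the
   value of the star, where h(x_1 + x_N) is the rate of the centre. *)
Require Import Defs.
From mathcomp Require Import all_boot all_order all_algebra.
From mathcomp Require Import reals exp.

Set Implicit Arguments.
Unset Strict Implicit.
Unset Printing Implicit Defensive.
Import Order.TTheory GRing.Theory Num.Theory.
Local Open Scope ring_scope.

(** Telescoping, each edge being charged to its source. The last vertex pays for no edge; its term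
    is covered by [0 <= d i]. *)
Lemma ler_sub_sum_path (R : realType) (T : eqType) (e : rel T) (H d : T -> R)
    (v : T) (p : seq T) :
  (forall i, 0 <= d i) -> (forall i j, e i j -> H i - H j <= d i) ->
  path e v p -> H v - H (last v p) <= \sum_(i <- v :: p) d i.
Proof.
move=> d0 dH; elim: p v => [|w p IHp] v /=.
  by rewrite big_seq1 subrr.
case/andP=> evw /IHp le_p; rewrite big_cons.
by rewrite -(subrK (H w) (H v)) -addrA lerD // dH.
Qed.

(** A simple path visits each vertex at most once, so its charges form a partial sum of the
    nonnegative terms [d i]. *)
Lemma ler_sub_sum_connect (R : realType) (T : finType) (e : rel T)
    (H d : T -> R) (u v : T) :
  (forall i, 0 <= d i) -> (forall i j, e i j -> H i - H j <= d i) ->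
  connect e u v -> H u - H v <= \sum_i d i.
Proof.
move=> d0 dH /connectP[p /shortenP[q euq uniq_q _] ->].
apply: le_trans (ler_sub_sum_path d0 dH euq) _.
rewrite big_uniq //= [leRHS](bigID (mem (u :: q))) /= lerDl.
by rewrite sumr_ge0.
Qed.

Lemma connect_neighbor (T : finType) (e : rel T) (u v : T) :
  u != v -> connect e u v -> exists w, e u w.
Proof.
move=> uv /connectP[[|w p] /=]; first by move=> _ vu; rewrite vu eqxx in uv.
by case/andP=> euw _ _; exists w.
Qed.

Lemma exists_ord_neq (N : nat) (i : 'I_N) : (2 <= N)%N -> exists j, i != j.
Proof.
move=> hN; have [->|iu] := eqVneq i (first_user hN).
  by exists (Ordinal hN).
by exists (first_user hN).
Qed.

Lemma set2_injl (T : finType) (a b c : T) : [set a; c] = [set b; c] -> a = b.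
Proof.
move=> eq_ac; have := set21 a c; rewrite eq_ac !inE => /orP[/eqP//|/eqP ac].
by have := set21 b c; rewrite -eq_ac ac !inE orbb => /eqP.
Qed.

Section Star.
Variables (N : nat) (hN : (2 <= N)%N).
Let u := first_user hN.
Let e := client_graph (star_ordering hN).

Lemma star_client_graph (i j : 'I_N) : e i j = ((i == u) (+) (j == u)).
Proof.
rewrite /e /client_graph; apply/imsetP/idP => [[k]|].
  (* Testing the equal pairs at [u] shows that [i] or [j] is the centre; testing them at [k], a
     leaf, shows that not both are. *)
  rewrite inE -/u => ku /setP eq_ij; have := eq_ij k; have := eq_ij u.
  rewrite !inE !eqxx (negPf ku) orbT [u == i]eq_sym [u == j]eq_sym.
  have [->|iu] := eqVneq i u; have [->|ju] := eqVneq j u => //= _.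
  by rewrite (negPf ku).
have [->|iu] := eqVneq i u; have [->|ju] := eqVneq j u => //= _.
  by exists j; rewrite ?inE // setUC.
by exists i; rewrite ?inE.
Qed.

Lemma star_feasible : feasible (star_ordering hN).
Proof.
split.
- by move=> P /imsetP[i]; rewrite inE => iu ->; rewrite cards2 iu.
- rewrite card_imset; last by move=> i j /set2_injl.
  rewrite -[in RHS](card_ord N) -(cardC1 u).
  by apply: eq_card => i; rewrite !inE.
split.
  suff eu v : connect e v u /\ connect e u v.
    by move=> v w; apply: connect_trans (eu v).1 (eu w).2.
  have [->|vu] := eqVneq v u; first by split; apply: connect0.
  by split; apply: connect1; rewrite star_client_graph eqxx (negPf vu).
(* Every edge has exactly one end at the centre. In a cycle a, b, c, ... with [b != u], both [a] and
   [c] would be the centre, so [b = u]. The vertex after [c] must then be the centre again: it is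
   either [a] or a later vertex, and both differ from [b]. *)
move=> [|a [|b [|c s]]] //; rewrite /ucycle -/e /= => /andP[].
case/and3P=> eab ebc ecs /and3P[].
rewrite !inE !negb_or => /and3P[ab ac _] /andP[bc bs] _.
move: eab ebc; rewrite !star_client_graph => eab ebc.
have b_u : b = u.
  apply/eqP; apply: contraT => bu; move: ac eab ebc; rewrite (negPf bu) /= addbF.
  by move=> ac /eqP au /eqP cu; rewrite au cu eqxx in ac.
move: bs ebc eab ecs; rewrite b_u eqxx /= => bs cu au.
by case: s bs => [|d s] /=; rewrite ?inE ?negb_or star_client_graph (negPf cu);
   [rewrite andbT => _ /= au'; rewrite au' in au
   | case/andP=> ud _ /andP[/= /eqP du]; rewrite du eqxx in ud].
Qed.

End Star.

Lemma min_over_eq (R : realType) (T : finType) (P : pred T) (F : T -> R) (k : T) :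
  P k -> (forall i, P i -> F k <= F i) -> min_over P F = F k.
Proof.
move=> Pk leF; have [[i Pi eqF] le_min] := min_overP F Pk.
by apply: le_anti; rewrite le_min // eqF leF.
Qed.

Lemma ln_prod_gt0 (R : realType) (I : Type) (r : seq I) (P : pred I) (F : I -> R) :
  (forall i, P i -> 0 < F i) ->
  ln (\prod_(i <- r | P i) F i) = \sum_(i <- r | P i) ln (F i).
Proof.
(* Positivity of the partial product is carried through the induction because [lnM] needs it. *)
move=> F0; suff [] : 0 < \prod_(i <- r | P i) F i /\
    ln (\prod_(i <- r | P i) F i) = \sum_(i <- r | P i) ln (F i) by [].
elim/big_rec2: _ => [|i y z Pi [z0 <-]]; first by rewrite ln1.
by rewrite lnM ?posrE ?mulr_gt0 ?F0.
Qed.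

Lemma ln2_gt0 (R : realType) : 0 < ln 2 :> R.
Proof. by rewrite ln_gt0 // ltr1n. Qed.

Lemma log2M (R : realType) (y z : R) :
  0 < y -> 0 < z -> log2 (y * z) = log2 y + log2 z.
Proof. by move=> y0 z0; rewrite /log2 lnM ?posrE // mulrDl. Qed.

Lemma log2_prod (R : realType) (I : Type) (r : seq I) (P : pred I) (F : I -> R) :
  (forall i, P i -> 0 < F i) ->
  log2 (\prod_(i <- r | P i) F i) = \sum_(i <- r | P i) log2 (F i).
Proof. by move=> F0; rewrite /log2 ln_prod_gt0 // mulr_suml. Qed.

Lemma ler_log2 (R : realType) (y z : R) : 0 < y -> y <= z -> log2 y <= log2 z.
Proof.
move=> y0 yz; rewrite /log2 ler_pM2r ?invr_gt0 ?ln2_gt0 //.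
by rewrite ler_ln ?posrE // (lt_le_trans y0).
Qed.

(** Since [log2] is nondecreasing and vanishes at 1, truncating the rate at 0 amounts to truncating
    its argument at 1. *)
Lemma max0_log2 (R : realType) (c y : R) :
  0 <= c -> 0 < y -> Num.max 0 (c * log2 y) = c * log2 (Num.max 1 y).
Proof.
move=> c0 y0; have log21 : log2 1 = 0 :> R by rewrite /log2 ln1 mul0r.
have [y1|/ltW y1] := leP y 1.
  by rewrite log21 mulr0 max_l // mulr_ge0_le0 // -log21 ler_log2.
by rewrite max_r // mulr_ge0 // -log21 ler_log2.
Qed.

Section Rates.
Variables (R : realType) (N : nat) (hN : (2 <= N)%N) (x : 'I_N -> R).
Hypothesis x_gt0 : forall i, 0 < x i.
Hypothesis x_mono : forall i j : 'I_N, (i <= j)%N -> x i <= x j.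
Let u := first_user hN.
Let w := last_user hN.
Let c : R := (2 * (N%:R - 1))^-1.
Let h (s : R) : R := c * log2 (1 + s^-1).

Lemma rate_coef_ge0 : 0 <= c.
Proof. by rewrite invr_ge0 mulr_ge0 ?subr_ge0 ?ler1n // (ltnW hN). Qed.

Lemma rate_arg_gt0 (i j : 'I_N) : 0 < x i + x i / (x i + x j).
Proof. by rewrite addr_gt0 ?divr_gt0 ?addr_gt0. Qed.

Lemma rate_boundE (i j : 'I_N) :
  rate_bound x i j = c * log2 (x i) + h (x i + x j).
Proof.
rewrite /rate_bound /h -mulrDr -log2M ?addr_gt0 ?invr_gt0 ?addr_gt0 //.
by rewrite [x i * (1 + _)]mulrDr mulr1.
Qed.

Lemma rate_excess_anti (s t : R) : 0 < s -> s <= t -> h t <= h s.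
Proof.
move=> s0 st; have t0 := lt_le_trans s0 st.
rewrite ler_wpM2l ?rate_coef_ge0 // ler_log2 ?addr_gt0 ?invr_gt0 //.
by rewrite lerD2l lef_pV2.
Qed.

Lemma first_user_le (i : 'I_N) : x u <= x i.
Proof. exact: x_mono. Qed.

Lemma le_last_user (i : 'I_N) : x i <= x w.
Proof. by apply: x_mono; rewrite /= -ltnS prednK ?(ltnW hN). Qed.

Lemma first_user_neq_last : w != u.
Proof. by rewrite -val_eqE /= -lt0n; case: N hN => [|[]]. Qed.

(** A leaf sees only the centre; the centre is limited by its strongest neighbour, because [h] is
    nonincreasing. *)
Lemma Bw_star (i : 'I_N) :
  Bw x (client_graph (star_ordering hN)) i
  = rate_bound x i (if i == u then w else u).
Proof.
apply: min_over_eq => [|j]; rewrite /= star_client_graph -/u.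
  by have [_|iu] := eqVneq i u; rewrite ?eqxx ?(negPf first_user_neq_last).
have [-> _|iu /= /eqP->//] := eqVneq i u.
by rewrite !rate_boundE lerD2l rate_excess_anti ?addr_gt0 ?lerD2l ?le_last_user.
Qed.

Lemma SRw_le_star (e : rel 'I_N) :
  (forall i j, connect e i j) ->
  SRw x e <= SRw x (client_graph (star_ordering hN)).
Proof.
(* [d i] measures how far user [i] falls below its rate when paired with [u]. For [i = u] this
   pairing is fictitious, with [H u] equal to [h (x u + x u)]; the surplus is corrected at the
   end. *)
move=> econn; pose H i := h (x i + x u).
pose d i := c * log2 (x i) + H i - Bw x e i.
have Bw_le i j : e i j -> Bw x e i <= rate_bound x i j.
  by move=> eij; have [_ ->] := min_overP (P := e i) (rate_bound x i) eij.
have d0 i : 0 <= d i.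
  (* A genuine neighbour is required: at an isolated vertex [Bw] would be the default value 0, which
     no rate bound controls. *)
  have [j ij] := exists_ord_neq i hN.
  have [k eik] := connect_neighbor ij (econn i j).
  rewrite subr_ge0 (le_trans (Bw_le i k eik)) // rate_boundE lerD2l.
  by rewrite rate_excess_anti ?addr_gt0 // lerD2l first_user_le.
have dH i j : e i j -> H i - H j <= d i.
  (* After cancelling [H i], the claim is that [Bw x e i] is at most [c * log2 (x i) + H j], which
     follows from [x u <= x i]. *)
  move=> eij; rewrite [d i]addrAC [leRHS]addrC lerD2l lerNl opprB.
  rewrite lerBlDr addrC (le_trans (Bw_le i j eij)) // rate_boundE lerD2l.
  by rewrite rate_excess_anti ?addr_gt0 // addrC lerD2r first_user_le.
have := ler_sub_sum_connect d0 dH (econn u w).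
(* The centre of the star has excess [h (x u + x w)], that is [H w], where [d u] contains [H u]. The
   correction [H u - H w] is exactly the drop along the path, so the two cancel. *)
suff -> : \sum_i d i
    = SRw x (client_graph (star_ordering hN)) + (H u - H w) - SRw x e.
  by rewrite addrAC -subr_ge0 addrK subr_ge0.
rewrite /d sumrB; congr (_ - _); rewrite /SRw (bigD1 u) // [in RHS](bigD1 u) //=.
rewrite Bw_star eqxx rate_boundE /H (addrC (x w)) [RHS]addrAC.
rewrite -[_ + _ + (_ - _)]addrA [h _ + (_ - _)]addrC subrK; congr (_ + _).
by apply: eq_bigr => i /negPf iu; rewrite Bw_star iu rate_boundE.
Qed.

Lemma SR_star :
  SR x (client_graph (star_ordering hN)) =
    c * log2 (Num.max 1 (x u + x u / (x u + x w)) *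
              \prod_(i < N | i != u) Num.max 1 (x i / (x i + x u) + x i)).
Proof.
have max_gt0 (y : R) : 0 < Num.max 1 y by rewrite lt_max ltr01.
rewrite log2M ?prodr_gt0 // log2_prod // mulrDr mulr_sumr /SR (bigD1 u) //=.
rewrite /B Bw_star eqxx max0_log2 ?rate_coef_ge0 ?rate_arg_gt0 //; congr (_ + _).
apply: eq_bigr => i /negPf iu; rewrite Bw_star iu addrC.
by rewrite max0_log2 ?rate_coef_ge0 ?rate_arg_gt0 // addrC.
Qed.

End Rates.

Theorem theorem3 (R : realType) (N : nat) (hN : (2 <= N)%N) (x : 'I_N -> R)
    (x_gt0 : 0 < x (first_user hN))
    (x_mono : forall i j : 'I_N, (i <= j)%N -> x i <= x j) :
  let U1 := first_user hN in
  let UN := last_user hN in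
  let O := star_ordering hN in
  optimal_ordering x O /\
  SR x (client_graph O) =
    (2 * (N%:R - 1))^-1 *
      log2 (Num.max 1 (x U1 + x U1 / (x U1 + x UN)) *
            \prod_(i < N | i != U1) Num.max 1 (x i / (x i + x U1) + x i)).
Proof.
have x_pos i : 0 < x i by apply: lt_le_trans x_gt0 (x_mono _ _ _).
split; last exact: SR_star.
split; first exact: star_feasible.
by move=> O' [_ _ [conn _]]; apply: SRw_le_star.
Qed.
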